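(* Let $M^m$ ($m\ge 2$) be a connected orientable Riemannian $m$-manifold and let $\gamma:I\to M^m$ be an arc length parametrized Frenet curve with Frenet frame $\{T,N,B_1,\ldots,B_{m-2}\}$ and curvatures $\kappa_1,\ldots,\kappa_{m-1}$. Let $\mathcal V$ be a smooth, nowhere zero vector field along $\gamma$ which is not parallel along $\gamma$, let $f:I\to\mathbb R$ and $\omega(T):I\to\mathbb R$ be smooth functions, and let $\theta:I\to[0,\pi]$ be a smooth function. Then the following are equivalent. (1) $\mathcal V$ is a torse-forming vector field along $\gamma$ with potential function $f$ and generating form $\omega$ (that is, $\nabla_T\mathcal V=fT+\omega(T)\mathcal V$), and $\gamma$ is a PA curve with $(\mathcal V,\theta)$. (2) There are smooth functions $\lambda_0,\ldots,\lambda_{m-2}:I\to\mathbb R$ such that $$\mathcal V=\lambda_0T+\cos\theta\,N+\lambda_1B_1+\cdots+\lambda_{m-2}B_{m-2},\qquad \cos^2\theta+\sum_{i=0}^{m-2}\lambda_i^2=1,$$ the curvatures of $\gamma$ satisfy the system $$\begin{aligned} &f(1-\lambda_0^2)-\lambda_0'+\kappa_1\cos\theta=0,\\ &-f\lambda_0\cos\theta+\theta'\sin\theta-\lambda_0\kappa_1+\lambda_1\kappa_2=0,\\ &-f\lambda_0\lambda_1-\lambda_1'+\lambda_2\kappa_3-\kappa_2\cos\theta=0\quad(\text{if } m\ge 3),\\ &-f\lambda_0\lambda_i-\lambda_i'-\lambda_{i-1}\kappa_{i+1}+\lambda_{i+1}\kappa_{i+2}=0,\quad 2\le i\le m-2,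 \end{aligned}$$ where any term containing $\lambda_{m-1}$ (the term $\lambda_{i+1}\kappa_{i+2}$ for $i=m-2$, and likewise $\lambda_1\kappa_2$ when $m=2$, $\lambda_2\kappa_3$ when $m=3$) is omitted, i.e. read as $0$; and $\omega(T)=-f\langle\mathcal V,T\rangle$.
   Context: $\nabla$ is the Levi-Civita connection, $I\subset\mathbb R$ an interval, and $'$ denotes differentiation with respect to arc length $s\in I$. Frenet curve: a smooth curve $\gamma:I\to M^m$ such that $\gamma',\nabla_{\gamma'}\gamma',\ldots,\nabla_{\gamma'}^{m-1}\gamma'$ are linearly independent along $I$. When parametrized by arc length it has a Frenet frame: a positively oriented orthonormal frame $X_1=\gamma',X_2,\ldots,X_m$ along $\gamma$, compatible with the spans of the successive covariant derivatives of $\gamma'$, and curvatures $\kappa_i>0$, $1\le i\le m-1$, such that $\nabla_{\gamma'}X_1=\kappa_1X_2$, $\nabla_{\gamma'}X_i=-\kappa_{i-1}X_{i-1}+\kappa_iX_{i+1}$ ($2\le i\le m-1$), $\nabla_{\gamma'}X_m=-\kappa_{m-1}X_{m-1}$. Notation: $T=\gamma'=X_1$, $N=X_2$ (principal normal), $B_i=X_{i+2}$. Torse-forming along $\gamma$: a vector field $\mathcal V$ along $\gamma$ is torse-forming along $\gamma$, with potential function $f$ and generating form $\omega$, if $\nabla_T\mathcal V=fT+\omega(T)\mathcal V$, where $f$ and $\omega(T)$ are smooth functions on $I$. It is parallel along $\gamma$ if $\nabla_T\mathcal V=0$ identically. PA (prescribed angle) curve: for a nowhere zero vector field $\mathcal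 V$ along an arc length parametrized Frenet curve $\gamma$ and a smooth $\theta:I\to[0,\pi]$, $\gamma$ is a PA curve with $(\mathcal V,\theta)$ if $\mathcal V$ has unit length along $\gamma$ and $\theta$ is the angle between $\mathcal V$ and the principal normal $N$, i.e. $\cos\theta=\langle\mathcal V,N\rangle$. *)

(* Defs.v *)
From HB Require Import structures.
From mathcomp Require Import all_boot all_order all_algebra.
From mathcomp Require Import all_classical all_reals all_analysis.
Import Order.TTheory GRing.Theory Num.Theory.
Import numFieldNormedType.Exports.

Set Implicit Arguments.
Unset Strict Implicit.
Unset Printing Implicit Defensive.

Local Open Scope classical_set_scope.
Local Open Scope ring_scope.

Section Calculus.
Context {R : realType}.

(* Derivative at s with the parameter restricted to A: one-sided at the end
   points of an interval, the usual derivative at interior points.  Only used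
   for A relatively open in a nondegenerate interval, so that no point of A is
   isolated. *)
Definition quotient_in (W : normedModType R) (A : set R) (f : R -> W) (s : R) :=
  (fun t : R => (t - s)^-1 *: (f t - f s)) @ within A s^'.

Definition derivable_in (W : normedModType R) (A : set R) (f : R -> W) s :=
  cvg (quotient_in A f s).

Definition derive_in (W : normedModType R) (A : set R) (f : R -> W) (s : R) : W :=
  lim (quotient_in A f s).

Definition smooth_in (W : normedModType R) (A : set R) (f : R -> W) :=
  forall k s, A s -> derivable_in A (iter k (derive_in A) f) s.

(* C^k maps on an open U. *)
Fixpoint Ck (V W : normedModType R) (k : nat) (U : set V) (f : V -> W) : Prop :=
  match k with
  | 0 => forall x, U x -> {for x, continuous f}
  | k'.+1 => (forall x, U x -> differentiable f x) /\
             (forall v, Ck k' U (fun x => 'd f x v))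
  end.

Definition smooth_on (V W : normedModType R) (U : set V) (f : V -> W) :=
  forall k, Ck k U f.

End Calculus.

Section Charts.
Context {R : realType} {m : nat} {M : topologicalType}.

(* [coord] is a homeomorphism from the open set [dom] onto an open subset of
   R^m, with inverse [param]; values elsewhere are irrelevant. *)
Record chart := Chart {
  dom : set M;
  coord : M -> 'rV[R]_m;
  param : 'rV[R]_m -> M;
  open_dom : open dom;
  open_img : open (coord @` dom);
  coordK : forall p, dom p -> param (coord p) = p;
  coord_continuous : forall p, dom p -> {for p, continuous coord};
  param_continuous : forall x, (coord @` dom) x -> {for x, continuous param}
}.

Definition transition (c d : chart) : 'rV[R]_m -> 'rV[R]_m := coord d \o param c.

Definition overlap (c d : chart) : set 'rV[R]_m := coord c @` (dom c `&` dom d).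

Definition compatible (c d : chart) :=
  smooth_on (overlap c d) (transition c d) /\
  smooth_on (overlap d c) (transition d c).

End Charts.
Arguments chart R m M : clear implicits.

(* [chart_at] selects a chart around each point; no notion below depends on the
   selection up to the resulting identification of tangent spaces with R^m. *)
Record smooth_manifold (R : realType) (m : nat) := SmoothManifold {
  points :> topologicalType;
  manifold_hausdorff : hausdorff_space points;
  manifold_second_countable : @second_countable points;
  atlas : set (chart R m points);
  chart_at : points -> chart R m points;
  chart_at_atlas : forall p, atlas (chart_at p);
  dom_chart_at : forall p, dom (chart_at p) p;
  atlas_compatible : forall c d, atlas c -> atlas d -> compatible c d;
  atlas_maximal :
    forall c, (forall d, atlas d -> compatible c d) -> atlas c
}.

Arguments atlas {R m} s.

Section Orientation.
Context {R : realType} {m : nat} (M : smooth_manifold R m).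

(* An orientation is given by an atlas of charts, the positively oriented ones,
   whose transition maps have positive Jacobian determinant. *)
Definition is_orientation (O : set (chart R m M)) :=
  [/\ O `<=` atlas M,
      forall p : M, exists2 c, O c & dom c p
    & forall c d (p : M), O c -> O d -> dom c p -> dom d p ->
        0 < \det (jacobian (transition c d) (coord c p)) ].

End Orientation.

Section Tangent.
Context {R : realType} {m : nat} {M : smooth_manifold R m}.

(* T_pM is R^m: a vector v stands for its components in [chart_at p].
   [to_chart c p v] are its components in c, and [of_chart c p u] is the tangent
   vector at p whose components in c are u. *)
Definition to_chart (c : chart R m M) (p : M) (v : 'rV[R]_m) : 'rV[R]_m :=
  'd (transition (chart_at p) c) (coord (chart_at p) p) v.

Definition of_chart (c : chart R m M) (p : M) (u : 'rV[R]_m) : 'rV[R]_m :=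
  'd (transition c (chart_at p)) (coord c p) u.

Definition form_at (G : M -> 'M[R]_m) (p : M) (v w : 'rV[R]_m) : R :=
  (v *m G p *m w^T) 0 0.

(* The matrix g_ij of G in the chart c, at the point with coordinates x. *)
Definition local_form (G : M -> 'M[R]_m) (c : chart R m M) (x : 'rV[R]_m) :
    'M[R]_m :=
  \matrix_(i, j) form_at G (param c x)
    (of_chart c (param c x) (delta_mx 0 i))
    (of_chart c (param c x) (delta_mx 0 j)).

End Tangent.

Record riemannian_metric (R : realType) (m : nat) (M : smooth_manifold R m) :=
  RiemannianMetric {
    metric_mx :> M -> 'M[R]_m;
    metric_sym : forall p v w,
      form_at metric_mx p v w = form_at metric_mx p w v;
    metric_pos : forall p v, v != 0 -> 0 < form_at metric_mx p v v;
    metric_smooth : forall c, atlas M c -> forall i j,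
      smooth_on (coord c @` dom c) (fun x => local_form metric_mx c x i j : R)
  }.

Section CovariantDerivative.
Context {R : realType} {m : nat} {M : smooth_manifold R m}.
Variable g : riemannian_metric M.

Definition inner (p : M) (v w : 'rV[R]_m) : R := form_at g p v w.

Definition tnorm (p : M) (v : 'rV[R]_m) : R := Num.sqrt (inner p v v).

(* The k-th partial derivative of g_ij in the chart c. *)
Definition dmetric (c : chart R m M) (x : 'rV[R]_m) (k i j : 'I_m) : R :=
  'd (fun y => local_form g c y i j : R) x (delta_mx 0 k).

(* Christoffel symbols Gamma^k_ij of the Levi-Civita connection. *)
Definition christoffel (c : chart R m M) (x : 'rV[R]_m) (k i j : 'I_m) : R :=
  2^-1 * \sum_l invmx (local_form g c x) k l *
    (dmetric c x i j l + dmetric c x j i l - dmetric c x l i j).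

Variables (I : set R) (gamma : R -> M).

Definition times_in (c : chart R m M) : set R := I `&` gamma @^-1` dom c.

Definition smooth_curve :=
  {within I, continuous gamma} /\
  forall c, atlas M c -> smooth_in (times_in c) (coord c \o gamma).

(* A vector field along gamma is V : R -> 'rV_m with V s in T_(gamma s)M. *)
Definition smooth_field (V : R -> 'rV[R]_m) :=
  forall c, atlas M c ->
    smooth_in (times_in c) (fun s => to_chart c (gamma s) (V s)).

Definition velocity (s : R) : 'rV[R]_m :=
  let c := chart_at (gamma s) in derive_in (times_in c) (coord c \o gamma) s.

(* nabla_(gamma') V, with components (v^k)' + Gamma^k_ij (x^i)' v^j in the
   chart at gamma s, where V s is its own row of components. *)
Definition cov_deriv (V : R -> 'rV[R]_m) (s : R) : 'rV[R]_m :=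
  let c := chart_at (gamma s) in
  derive_in (times_in c) (fun t => to_chart c (gamma t) (V t)) s +
  \row_k \sum_i \sum_j
    christoffel c (coord c (gamma s)) k i j * velocity s 0 i * V s 0 j.

Definition arc_length := forall s, I s -> tnorm (gamma s) (velocity s) = 1.

Definition frenet_curve :=
  smooth_curve /\
  forall s, I s -> row_free (\matrix_(k < m) iter k cov_deriv velocity s).

(* Indexed as X_1, ..., X_m and kappa_1, ..., kappa_(m-1); other indices are
   irrelevant. *)
Record frenet_frame (O : set (chart R m M))
    (X : nat -> R -> 'rV[R]_m) (kappa : nat -> R -> R) : Prop := {
  frame_smooth : forall i, (1 <= i <= m)%N -> smooth_field (X i);
  frame_orthonormal : forall i j s,
    (1 <= i <= m)%N -> (1 <= j <= m)%N -> I s ->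
    inner (gamma s) (X i s) (X j s) = (i == j)%:R;
  frame_tangent : forall s, I s -> X 1%N s = velocity s;
  frame_span : forall k s, (1 <= k <= m)%N -> I s ->
    (\matrix_(i < k) X i.+1 s ==
     \matrix_(i < k) iter i cov_deriv velocity s)%MS;
  frame_positive : forall c s, O c -> I s -> dom c (gamma s) ->
    0 < \det (\matrix_(i < m) to_chart c (gamma s) (X i.+1 s));
  curvature_smooth : forall i, (1 <= i <= m.-1)%N -> smooth_in I (kappa i);
  curvature_pos : forall i s, (1 <= i <= m.-1)%N -> I s -> 0 < kappa i s;
  frenet_first : forall s, I s ->
    cov_deriv (X 1%N) s = kappa 1%N s *: X 2%N s;
  frenet_middle : forall i s, (2 <= i <= m.-1)%N -> I s ->
    cov_deriv (X i) s =
      - kappa i.-1 s *: X i.-1 s + kappa i s *: X i.+1 s;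
  frenet_last : forall s, I s ->
    cov_deriv (X m) s = - kappa m.-1 s *: X m.-1 s
}.

Definition nowhere_zero (V : R -> 'rV[R]_m) := forall s, I s -> V s != 0.

Definition parallel (V : R -> 'rV[R]_m) := forall s, I s -> cov_deriv V s = 0.

(* w is the function omega(T). *)
Definition torse_forming (V : R -> 'rV[R]_m) (f w : R -> R) :=
  [/\ smooth_in I f, smooth_in I w
    & forall s, I s -> cov_deriv V s = f s *: velocity s + w s *: V s].

(* N is the principal normal. *)
Definition PA_curve (N V : R -> 'rV[R]_m) (theta : R -> R) :=
  forall s, I s ->
    tnorm (gamma s) (V s) = 1 /\ cos (theta s) = inner (gamma s) (V s) (N s).

End CovariantDerivative.

(* The family l_0, ..., l_(n-1) continued by zero. *)
Definition trunc (R : realType) (n : nat) (l : nat -> R -> R) (i : nat) (s : R) : R :=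
  if (i < n)%N then l i s else 0.

(* Main.v *)
Require Import Defs.
From HB Require Import structures.
From mathcomp Require Import all_boot all_order all_algebra.
From mathcomp Require Import all_classical all_reals all_analysis.
From mathcomp Require Import ring lra zify.
Import Order.TTheory GRing.Theory Num.Theory.
Import numFieldNormedType.Exports.

Local Open Scope classical_set_scope.
Local Open Scope ring_scope.

Set Implicit Arguments.
Unset Strict Implicit.

(** Write [c_k = <V, X_k>] for the components of [V] in the Frenet frame, with
    [c_0 = c_(m+1) = 0].  The covariant derivative along [gamma] is compatible with
    the metric, so the Frenet equations give
    [<nabla_T V, X_k> = c_k' + kappa_(k-1) c_(k-1) - kappa_k c_(k+1)].
    As the frame is a basis of each tangent space, [nabla_T V = f T + w V] is
    equivalent to
    [c_k' = f delta_(k,1) + w c_k - kappa_(k-1) c_(k-1) + kappa_k c_(k+1)],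
    [1 <= k <= m] ([torse_components]).  With [c_1 = lambda_0], [c_2 = cos theta],
    [c_(i+2) = lambda_i] and [w = - f lambda_0] these are the equations of the
    system ([torse_components_system]).  The formula for [w] comes from
    differentiating [<V, V> = 1] ([torse_unit_form]), and the expansion of [V] and
    the sum of squares are the expansion and Parseval identity in an orthonormal
    basis.

    Most of the work is metric compatibility ([metric_compatibility]).  Tangent
    vectors are stored in a chart that depends on the base point, without any
    continuity; one first rewrites inner products in a single chart
    ([inner_local_form]), differentiates the resulting sum of products by the
    product and chain rules, and uses that the lowered Christoffel symbols satisfy
    [Gamma_(a b, j) + Gamma_(a j, b) = d_a g_(b j)].  The same chart expression
    shows that the components [c_k] are smooth ([smooth_inner]).  Derivatives are
    one-sided at the end points of [I], so the rules of differential calculus are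
    established for derivatives along a set of parameters. *)

(** * One-sided derivatives and their calculus rules *)

Section DerivativesOnASet.
Context {R : realType}.
Implicit Types (A : set R) (s : R).

(** A relational derivative: the calculus rules below then hold without asking
    that limits along the filter be unique. *)
Definition has_derive_in {W : normedModType R} A (h : R -> W) s (d : W) :=
  (fun t : R => (t - s)^-1 *: (h t - h s)) @ within A s^' --> d.

(** This makes limits of difference quotients unique, hence the totalized
    derivative meaningful. *)
Definition no_isolated_point A := forall s, A s -> ProperFilter (within A s^').

Lemma cvg_eq_near {T : topologicalType} {F : set_system R} {FF : Filter F}
    (h1 h2 : R -> T) (l : T) :
  (\forall t \near F, h1 t = h2 t) -> h1 @ F --> l -> h2 @ F --> l.
Proof. by move=> e; apply: cvg_trans; exact: near_eq_cvg. Qed.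

Lemma has_derive_in_derive (W : normedModType R) A (h : R -> W) s :
  derivable_in A h s -> has_derive_in A h s (derive_in A h s).
Proof. by []. Qed.

Lemma has_derive_in_derivable (W : normedModType R) A (h : R -> W) s d :
  has_derive_in A h s d -> derivable_in A h s.
Proof. by move=> hd; apply/cvg_ex; exists d. Qed.

Lemma derive_inE (W : normedModType R) A (h : R -> W) s d :
  no_isolated_point A -> A s -> has_derive_in A h s d -> derive_in A h s = d.
Proof. by move=> aA As; have := aA s As => PF; apply: cvg_lim; exact: norm_hausdorff. Qed.

Lemma has_derive_in_eq (W : normedModType R) A (h1 h2 : R -> W) s d :
  A s -> (forall t, A t -> h1 t = h2 t) ->
  has_derive_in A h1 s d -> has_derive_in A h2 s d.
Proof.
move=> As e; apply: cvg_eq_near.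
have : \forall t \near within A s^', A t by exact: withinT.
by apply: filterS => t At; rewrite !e.
Qed.

Lemma near_within_dnbhs_neq A s : \forall t \near within A s^', t != s.
Proof. by apply: (@cvg_within _ s^' _ A); exact: withinT. Qed.

Lemma has_derive_in_continuous (W : normedModType R) A (h : R -> W) s d :
  has_derive_in A h s d -> h t @[t --> within A s^'] --> h s.
Proof.
move=> hd.
have ts : (t - s) @[t --> within A s^'] --> (0 : R).
  rewrite -(subrr s); apply: cvgB; last exact: cvg_cst.
  exact: cvg_trans (@cvg_within _ s^' _ A) (@nbhs_dnbhs _ s).
have := cvgD (cvgZ ts hd) (cvg_cst (h s)).
rewrite scale0r add0r => /(_ _ _ _); apply: cvg_eq_near.
apply: filterS (near_within_dnbhs_neq A s) => t ts0 /=.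
rewrite -[LHS]/(_ + h s).
by rewrite scalerA divff ?subr_eq0// scale1r subrK.
Qed.

Lemma has_derive_inD (W : normedModType R) A (h1 h2 : R -> W) s d1 d2 :
  has_derive_in A h1 s d1 -> has_derive_in A h2 s d2 ->
  has_derive_in A (fun t => h1 t + h2 t) s (d1 + d2).
Proof.
move=> hd1 hd2; have /(_ _) := cvgD hd1 hd2; apply: cvg_eq_near.
by apply: nearW => t; rewrite -[LHS]/(_ *: _ + _ *: _) -scalerDr opprD addrACA.
Qed.

Lemma has_derive_in_cst (W : normedModType R) A (w : W) s :
  has_derive_in A (fun=> w) s 0.
Proof.
rewrite /has_derive_in; under eq_fun do rewrite subrr scaler0.
exact: cvg_cst.
Qed.

Lemma has_derive_inM A (h1 h2 : R -> R) s d1 d2 :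
  has_derive_in A h1 s d1 -> has_derive_in A h2 s d2 ->
  has_derive_in A (fun t => h1 t * h2 t) s (d1 * h2 s + h1 s * d2).
Proof.
move=> hd1 hd2; have c2 := has_derive_in_continuous hd2.
have := cvgD (cvgM hd1 c2) (cvgM (cvg_cst (h1 s)) hd2) => /(_ _ _ _ _ _).
apply: cvg_eq_near.
by apply: nearW => t; rewrite -[LHS]/(_ * _ * h2 t + h1 s * (_ * _)) /GRing.scale/=; ring.
Qed.

Lemma has_derive_in_sum A (J : Type) (r : seq J) (h : J -> R -> R) d s :
  (forall j, has_derive_in A (h j) s (d j)) ->
  has_derive_in A (fun t => \sum_(j <- r) h j t) s (\sum_(j <- r) d j).
Proof.
move=> hd; elim: r => [|j r IH].
  under [X in has_derive_in _ X]eq_fun do rewrite big_nil.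
  by rewrite big_nil; exact: has_derive_in_cst.
under [X in has_derive_in _ X]eq_fun do rewrite big_cons.
by rewrite big_cons; exact: has_derive_inD.
Qed.

(** The error of the affine approximation of [F] is [o(|x t - x s|)], and
    [|x t - x s| / |t - s|] stays bounded because [x] has a derivative. *)
Lemma has_derive_in_comp (V W : normedModType R) A (F : V -> W) (x : R -> V) s v :
  differentiable F (x s) -> has_derive_in A x s v ->
  has_derive_in A (fun t => F (x t)) s ('d F (x s) v).
Proof.
move=> /diff_locallyP[dFc /eqaddoP eqF] hx.
have c := has_derive_in_continuous hx.
have c0 : (x t - x s) @[t --> within A s^'] --> (0 : V).
  by rewrite -(subrr (x s)); apply: cvgB c (cvg_cst _).
have lin : 'd F (x s) ((t - s)^-1 *: (x t - x s)) @[t --> within A s^'] -->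
    'd F (x s) v.
  exact: continuous_cvg (dFc v) hx.
rewrite /has_derive_in -[X in _ --> X]addr0.
suff rest : (t - s)^-1 *: (F (x t) - F (x s) - 'd F (x s) (x t - x s))
    @[t --> within A s^'] --> (0 : W).
  have /(_ _) := cvgD lin rest; apply: cvg_eq_near.
  apply: nearW => t; rewrite -[LHS]/(_ + _ *: _) linearZ -scalerDr.
  by rewrite [X in _ *: X]addrC subrK.
apply/cvgrPdist_le => e e0.
have k0 : 0 < `|v| + 1 by rewrite ltr_wpDl.
have := eqF _ (divr_gt0 e0 k0) => /c0 small.
(* eventually the quotient is within distance 1 of its limit [v] *)
have bnd : \forall t \near within A s^', `|(t - s)^-1 *: (x t - x s)| <= `|v| + 1.
  move/cvgrPdist_le : hx => /(_ 1 ltr01); apply: filterS => t vt.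
  rewrite -[X in `|X|](subrK v) -normrN opprD addrC opprB.
  by rewrite (le_trans (ler_normD _ _))// normrN lerD2l.
near=> t; rewrite sub0r normrN normrZ.
have /= : `|(F \o shift (x s) - (cst (F (x s)) + 'd F (x s))) (x t - x s)|
    <= e / (`|v| + 1) * `|x t - x s| by near: t.
rewrite -[X in `|X|]/(F (x t - x s + x s) - (F (x s) + 'd F (x s) (x t - x s))).
rewrite subrK opprD addrA => h.
rewrite (le_trans (ler_wpM2l _ h))//.
rewrite mulrCA -[X in _ * X <= _]normrZ mulrAC ler_pdivrMr// ler_pM2l//.
by near: t.
Unshelve. all: by end_near.
Qed.

End DerivativesOnASet.


(** * Smooth functions on a set without isolated points *)

Section SmoothnessOnASet.
Context {R : realType}.
Implicit Types (A : set R) (s : R).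

(** [k]-fold differentiability with the derivative taken first: closure under
    operations can then be proved by induction on [k] with the function
    generalized, which the iterates in [smooth_in] do not allow directly. *)
Fixpoint Ck_in {W : normedModType R} A k (h : R -> W) : Prop :=
  if k is k'.+1 then
    (forall s, A s -> derivable_in A h s) /\ Ck_in A k' (derive_in A h)
  else True.

Lemma smooth_inP (W : normedModType R) A (h : R -> W) :
  smooth_in A h <-> forall k, Ck_in A k h.
Proof.
split=> [sh k|]; last first.
  move=> Ch k; elim: k h Ch => [|k IH] h Ch s As; first exact: (Ch 1%N).1.
  by rewrite iterSr; apply: IH => // j; exact: (Ch j.+1).2.
elim: k h sh => //= k IH h sh; split; first by move=> s; exact: (sh 0%N).
by apply: IH => j s As; rewrite -iterSr; exact: sh.
Qed.

Lemma smooth_in_derivable (W : normedModType R) A (h : R -> W) s :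
  smooth_in A h -> A s -> derivable_in A h s.
Proof. by move=> /(_ 0%N) + As => /(_ s As). Qed.

Lemma quotient_in_eq (W : normedModType R) A (h1 h2 : R -> W) s :
  A s -> (forall t, A t -> h1 t = h2 t) -> quotient_in A h1 s = quotient_in A h2 s.
Proof.
move=> As e; suff sub (f g : R -> W) : (forall t, A t -> f t = g t) ->
    f @ within A s^' `<=` g @ within A s^'.
  by apply/seteqP; split; apply: sub => t At; rewrite !e.
move=> fg P; rewrite /nbhs/=; apply: filter_app.
have : \forall t \near within A s^', A t by exact: withinT.
by apply: filterS => t At; rewrite /= fg.
Qed.

Lemma derive_in_eq (W : normedModType R) A (h1 h2 : R -> W) s :
  A s -> (forall t, A t -> h1 t = h2 t) -> derive_in A h1 s = derive_in A h2 s.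
Proof. by move=> As e; rewrite /derive_in (quotient_in_eq As e). Qed.

Lemma Ck_in_eq (W : normedModType R) A k (h1 h2 : R -> W) :
  (forall t, A t -> h1 t = h2 t) -> Ck_in A k h1 -> Ck_in A k h2.
Proof.
elim: k h1 h2 => //= k IH h1 h2 e [d1 C1]; split.
  by move=> s As; rewrite /derivable_in -(quotient_in_eq As e); exact: d1.
by apply: IH C1 => s As; exact: derive_in_eq.
Qed.

Lemma Ck_inW (W : normedModType R) A k (h : R -> W) : Ck_in A k.+1 h -> Ck_in A k h.
Proof.
elim: k h => // k IH h [dh Ch]; split=> //.
exact: IH.
Qed.

Section Closure.
Variable (A : set R).
Hypothesis aA : no_isolated_point A.

(** Values of the derivative outside [A] are junk, so a candidate derivative has
    to agree with it on [A] only. *)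
Lemma Ck_inS_has_derive (W : normedModType R) k (h h' : R -> W) :
  (forall s, A s -> has_derive_in A h s (h' s)) -> Ck_in A k h' -> Ck_in A k.+1 h.
Proof.
move=> dh Ch; split; first by move=> s As; exact: has_derive_in_derivable (dh s As).
by apply: Ck_in_eq Ch => s As; rewrite (derive_inE aA As (dh s As)).
Qed.

Lemma Ck_in_cst (W : normedModType R) k (w : W) : Ck_in A k (fun=> w).
Proof.
elim: k w => // k IH w; apply: (@Ck_inS_has_derive _ _ _ (fun=> 0)) => // s _.
exact: has_derive_in_cst.
Qed.

Lemma Ck_inD (W : normedModType R) k (h1 h2 : R -> W) :
  Ck_in A k h1 -> Ck_in A k h2 -> Ck_in A k (fun t => h1 t + h2 t).
Proof.
elim: k h1 h2 => // k IH h1 h2 [d1 C1] [d2 C2].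
apply: Ck_inS_has_derive (IH _ _ C1 C2) => s As.
by apply: has_derive_inD; apply: has_derive_in_derive; [exact: d1|exact: d2].
Qed.

Lemma Ck_inM k (h1 h2 : R -> R) :
  Ck_in A k h1 -> Ck_in A k h2 -> Ck_in A k (fun t => h1 t * h2 t).
Proof.
elim: k h1 h2 => // k IH h1 h2 C1 C2.
have [[d1 C1'] [d2 C2']] := (C1, C2).
apply: (@Ck_inS_has_derive _ _ _
    (fun t => derive_in A h1 t * h2 t + h1 t * derive_in A h2 t)).
  by move=> s As; apply: has_derive_inM; apply: has_derive_in_derive;
    [exact: d1|exact: d2].
by apply: Ck_inD; apply: IH => //; exact: Ck_inW.
Qed.

Lemma Ck_in_sum k (J : Type) (r : seq J) (h : J -> R -> R) :
  (forall j, Ck_in A k (h j)) -> Ck_in A k (fun t => \sum_(j <- r) h j t).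
Proof.
move=> Ch; elim: r => [|j r IH].
  by apply: Ck_in_eq (Ck_in_cst k (0 : R)) => t _; rewrite big_nil.
by apply: Ck_in_eq (Ck_inD (Ch j) IH) => t _; rewrite big_cons.
Qed.

Lemma has_derive_in_coord m (x : R -> 'rV[R]_m) s v j :
  has_derive_in A x s v -> has_derive_in A (fun t => x t 0 j) s (v 0 j).
Proof.
move=> dx; have /(_ _) := continuous_cvg _ (@coord_continuous R 1 m 0 j v) dx.
by apply: cvg_eq_near; apply: nearW => t; rewrite -[LHS]/((_ *: (_ - _) : 'rV[R]_m) 0 j) !mxE.
Qed.

Lemma Ck_in_coord m k (x : R -> 'rV[R]_m) j :
  Ck_in A k x -> Ck_in A k (fun t => x t 0 j).
Proof.
elim: k x => // k IH x [dx Cx].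
apply: Ck_inS_has_derive (IH _ Cx) => s As.
by apply: has_derive_in_coord; apply: has_derive_in_derive; exact: dx.
Qed.

Lemma diff_delta m (F : 'rV[R]_m -> R) p (v : 'rV[R]_m) :
  'd F p v = \sum_j v 0 j * 'd F p (delta_mx 0 j).
Proof.
rewrite {1}(row_sum_delta v) linear_sum; apply: eq_bigr => j _.
by rewrite linearZ.
Qed.

(** By the chain rule the derivative of [F o x] is the sum of the products of the
    [x'_j] with [(dF e_j) o x], and each [dF e_j] is again smooth: induction on the
    order, with [F] generalized. *)
Lemma Ck_in_comp m k (U : set 'rV[R]_m) (F : 'rV[R]_m -> R) (x : R -> 'rV[R]_m) :
  smooth_on U F -> smooth_in A x -> (forall s, A s -> U (x s)) ->
  Ck_in A k (fun t => F (x t)).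
Proof.
move=> + /smooth_inP Cx xU; elim: k F => // k IH F CF.
apply: (@Ck_inS_has_derive _ _ _
    (fun t => \sum_j derive_in A x t 0 j * 'd F (x t) (delta_mx 0 j))).
  move=> s As; rewrite -diff_delta; apply: has_derive_in_comp.
    exact: (CF 1%N).1 (xU s As).
  by apply: has_derive_in_derive; exact: (Cx 1%N).1.
apply: Ck_in_sum => j; apply: Ck_inM.
  by apply: Ck_in_coord; exact: (Cx k.+1).2.
by apply: (IH (fun y => 'd F y (delta_mx 0 j))) => n; exact: (CF n.+1).2.
Qed.

End Closure.

(** The hypothesis on the filters says that [B] is relatively open in [A]; then
    derivatives in [A] and in [B], hence their iterates, agree on [B]. *)
Lemma smooth_in_local (W : normedModType R) A (h : R -> W) :
  (forall s, A s -> exists B : set R, [/\ B s, B `<=` A,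
     forall t, B t -> within B t^' = within A t^' & smooth_in B h]) ->
  smooth_in A h.
Proof.
move=> loc k s /loc[B [Bs BA eB sB]].
have e j t : B t -> iter j (derive_in B) h t = iter j (derive_in A) h t.
  elim: j t => //= j IH t Bt.
  by rewrite (derive_in_eq Bt IH) /derive_in /quotient_in eB.
have := sB k s Bs.
by rewrite /derivable_in (quotient_in_eq Bs (e k)) /quotient_in eB.
Qed.

Lemma no_isolated_point_interval A :
  is_interval A -> (exists a b, [/\ A a, A b & a < b]) -> no_isolated_point A.
Proof.
move=> iA [a [b [Aa Ab ab]]] s As.
have [c Ac cs] : exists2 c, A c & c != s.
  by have [eas|] := eqVneq a s; [exists b; rewrite // -eas gt_eqF|exists a].
apply: Build_ProperFilter_ex => P /nbhs_ballP[e /= e0 eP].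
pose k := Num.min 1 (e / 2 / `|c - s|).
have n0 : 0 < `|c - s| by rewrite normr_gt0 subr_eq0.
have k0 : 0 < k by rewrite lt_min ltr01/= !divr_gt0.
have k1 : k <= 1 by rewrite ge_min lexx.
have ke : k * `|c - s| < e.
  have : k <= e / 2 / `|c - s| by rewrite ge_min lexx orbT.
  by rewrite ler_pdivlMr// => h; rewrite (le_lt_trans h)// gtr_pMr// invf_lt1// ltr1n.
have As' : A (s + k * (c - s)).
  have [lcs|lsc] := leP c s.
    apply: (iA c s) => //; apply/andP; split; nra.
  apply: (iA s c) => //; apply/andP; split; nra.
exists (s + k * (c - s)); apply: eP => //.
  rewrite /ball/= opprD addrA subrr sub0r normrN normrM.
  by rewrite (gtr0_norm k0).
by rewrite -subr_eq0 addrAC subrr add0r mulf_eq0 (gt_eqF k0) subr_eq0.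
Qed.

End SmoothnessOnASet.


(** * Tangent vectors and the metric in a chart *)

Section TangentCoordinates.
Context {R : realType} {m : nat} {M : smooth_manifold R m}.
Implicit Types (c d : chart R m M) (p : M).

Lemma diff_near_id (F : 'rV[R]_m -> 'rV[R]_m) x v :
  differentiable F x -> (\forall y \near x, F y = y) -> 'd F x v = v.
Proof.
move=> dF eF.
rewrite -deriveE// (@near_eq_derive _ _ _ _ id _ _ eF).
exact: derive_id.
Qed.

(** Overlaps are open: differentials at their points only see points common to
    both chart domains. *)
Lemma overlap_nbhs c d p :
  dom c p -> dom d p -> \forall y \near Defs.coord c p, overlap c d y.
Proof.
move=> cp dp.
have inc : \forall y \near Defs.coord c p, (Defs.coord c @` dom c) y.
  by apply: open_nbhs_nbhs; split; [exact: open_img|exists p].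
have ind : \forall y \near Defs.coord c p, dom d (param c y).
  have /param_continuous : (Defs.coord c @` dom c) (Defs.coord c p) by exists p.
  apply; rewrite coordK//; apply: open_nbhs_nbhs; split => //.
  exact: open_dom.
near=> y; have [q cq qy] : (Defs.coord c @` dom c) y by near: y.
exists q => //; split=> //; rewrite -(coordK cq) qy.
by near: y.
Unshelve. all: by end_near.
Qed.

Lemma differentiable_transition c d p : atlas M c -> atlas M d ->
  dom c p -> dom d p -> differentiable (transition c d) (Defs.coord c p).
Proof.
move=> ac ad cp dp; have [/(_ 1%N)[+ _] _] := atlas_compatible ac ad.
by apply; exists p.
Qed.

Lemma diff_transition_self c p v : atlas M c -> dom c p ->
  'd (transition c c) (Defs.coord c p) v = v.
Proof.
move=> ac cp; apply: diff_near_id; first exact: differentiable_transition.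
apply: filterS (overlap_nbhs cp cp) => _ [q [cq _] <-].
by rewrite /transition/= coordK.
Qed.

(** The two transition maps are inverse to each other near the point, so the
    chain rule makes their differentials inverse. *)
Lemma diff_transitionK c d p v : atlas M c -> atlas M d ->
  dom c p -> dom d p ->
  'd (transition d c) (Defs.coord d p) ('d (transition c d) (Defs.coord c p) v) = v.
Proof.
move=> ac ad cp dp.
have tp : transition c d (Defs.coord c p) = Defs.coord d p.
  by rewrite /transition/= coordK.
have d1 := differentiable_transition ac ad cp dp.
have d2 : differentiable (transition d c) (transition c d (Defs.coord c p)).
  by rewrite tp; exact: differentiable_transition.
rewrite -tp -[LHS]/(('d _ _ \o 'd _ _) v) -diff_comp//.
apply: diff_near_id; first exact: differentiable_comp.
apply: filterS (overlap_nbhs cp dp) => _ [q [cq dq] <-].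
by rewrite /transition/= !coordK.
Qed.

Lemma to_chart_self p v : to_chart (chart_at p) p v = v.
Proof. exact: diff_transition_self (chart_at_atlas p) (dom_chart_at p). Qed.

Lemma of_chart_self p v : of_chart (chart_at p) p v = v.
Proof. exact: diff_transition_self (chart_at_atlas p) (dom_chart_at p). Qed.

Lemma to_chartK c p v : atlas M c -> dom c p -> of_chart c p (to_chart c p v) = v.
Proof.
move=> ac cp.
exact: diff_transitionK (chart_at_atlas p) ac (dom_chart_at p) cp.
Qed.

Lemma of_chart_sum c p u :
  of_chart c p u = \sum_i u 0 i *: of_chart c p (delta_mx 0 i).
Proof.
rewrite /of_chart {1}(row_sum_delta u) linear_sum; apply: eq_bigr => i _.
by rewrite linearZ.
Qed.

End TangentCoordinates.

Section MetricInCoordinates.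
Context {R : realType} {m : nat} {M : smooth_manifold R m}.
Variable g : riemannian_metric M.
Implicit Types (c : chart R m M) (p : M).

Lemma innerC p v w : inner g p v w = inner g p w v.
Proof. exact: Defs.metric_sym. Qed.

Lemma inner_suml p (J : Type) (r : seq J) (a : J -> R) (v : J -> 'rV[R]_m) w :
  inner g p (\sum_(j <- r) a j *: v j) w = \sum_(j <- r) a j * inner g p (v j) w.
Proof.
rewrite /inner /form_at !mulmx_suml summxE; apply: eq_bigr => j _.
by rewrite -!scalemxAl mxE.
Qed.

Lemma inner_sumr p (J : Type) (r : seq J) (a : J -> R) (v : J -> 'rV[R]_m) w :
  inner g p w (\sum_(j <- r) a j *: v j) = \sum_(j <- r) a j * inner g p w (v j).
Proof.
rewrite innerC inner_suml; apply: eq_bigr => j _.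
by rewrite innerC.
Qed.

Lemma innerDl p u v w : inner g p (u + v) w = inner g p u w + inner g p v w.
Proof. by rewrite /inner /form_at !mulmxDl mxE. Qed.

Lemma innerZl p a v w : inner g p (a *: v) w = a * inner g p v w.
Proof. by rewrite /inner /form_at -!scalemxAl mxE. Qed.

Lemma innerDr p u v w : inner g p w (u + v) = inner g p w u + inner g p w v.
Proof. by rewrite innerC innerDl !(innerC _ w). Qed.

Lemma innerZr p a v w : inner g p w (a *: v) = a * inner g p w v.
Proof. by rewrite innerC innerZl innerC. Qed.

(** The expression of the inner product in an arbitrary chart: it is what makes
    [inner] differentiable along a curve, since the preferred charts used in its
    definition jump with the base point. *)
Lemma inner_local_form c p v w : atlas M c -> dom c p ->
  inner g p v w = \sum_i \sum_j
    to_chart c p v 0 i * local_form g c (Defs.coord c p) i j * to_chart c p w 0 j.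
Proof.
move=> ac cp; rewrite -{1}(to_chartK v ac cp) -{1}(to_chartK w ac cp).
rewrite (of_chart_sum c p (to_chart c p v)) inner_suml; apply: eq_bigr => i _.
rewrite (of_chart_sum c p (to_chart c p w)) inner_sumr mulr_sumr.
apply: eq_bigr => j _.
by rewrite /local_form mxE coordK// -mulrA [in RHS](mulrC (form_at _ _ _ _)).
Qed.

Lemma local_formC c x i j : local_form g c x i j = local_form g c x j i.
Proof. by rewrite !mxE Defs.metric_sym. Qed.

Lemma dmetricC c x k i j : dmetric g c x k i j = dmetric g c x k j i.
Proof.
by rewrite /dmetric; congr ('d _ x _); apply/funext => y; rewrite local_formC.
Qed.

Lemma local_form_self p : local_form g (chart_at p) (Defs.coord (chart_at p) p) = g p.
Proof.
apply/matrixP => i j; rewrite mxE coordK; last exact: dom_chart_at.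
by rewrite !of_chart_self /form_at -rowE trmx_delta -colE !mxE.
Qed.

Lemma metric_unit p : (g p : 'M[R]_m) \in unitmx.
Proof.
rewrite unitmxE unitfE; apply/det0P => -[v v0 vg].
by have := metric_pos g p v0; rewrite /form_at vg mul0mx mxE ltxx.
Qed.

(** Contracting with the metric cancels its inverse in the Christoffel symbols.
    In the preferred chart at [p] the Gram matrix is [g p] itself, which is
    invertible by positive definiteness. *)
Lemma christoffel_lower p a b j :
  let c := chart_at p in let x := Defs.coord c p in
  \sum_i christoffel g c x i a b * local_form g c x i j =
  2^-1 * (dmetric g c x a b j + dmetric g c x b a j - dmetric g c x j a b).
Proof.
move=> c x; rewrite /christoffel.
have gu : local_form g c x \in unitmx by rewrite local_form_self metric_unit.
transitivity (2^-1 * \sum_l (local_form g c x *m invmx (local_form g c x)) j l *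
   (dmetric g c x a b l + dmetric g c x b a l - dmetric g c x l a b)).
  under eq_bigr do rewrite -mulrA mulr_suml.
  rewrite -mulr_sumr exchange_big/=; congr (_ * _); apply: eq_bigr => l _.
  rewrite mxE mulr_suml; apply: eq_bigr => i _.
  by rewrite (local_formC c x i j); ring.
rewrite mulmxV// (bigD1 j)//= big1 ?addr0; first by rewrite mxE eqxx mul1r.
by move=> l /negPf lj; rewrite mxE eq_sym lj mul0r.
Qed.

End MetricInCoordinates.

(** With [Gam] the Christoffel symbols, [L] their lowered form and [D] the partial
    derivatives of the metric, this is [nabla g = 0] contracted with three vectors.
    The only geometric input is the relation between [L] and [D]; the rest is
    renaming of summation indices. *)
Lemma lowered_connection_metric (R : comNzRingType) (m : nat)
    (Gam L D : 'I_m -> 'I_m -> 'I_m -> R) (G : 'I_m -> 'I_m -> R)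
    (x v w : 'I_m -> R) :
  (forall i j, G i j = G j i) ->
  (forall a b j, \sum_i Gam i a b * G i j = L a b j) ->
  (forall a b j, L a b j + L a j b = D a b j) ->
  \sum_i \sum_j v i * (\sum_k x k * D k i j) * w j =
  \sum_i \sum_j (\sum_a \sum_b Gam i a b * x a * v b) * G i j * w j +
  \sum_i \sum_j v i * G i j * (\sum_a \sum_b Gam j a b * x a * w b).
Proof.
move=> symG GamL LD.
have lower (u : 'I_m -> R) j : \sum_i (\sum_a \sum_b Gam i a b * x a * u b) * G i j =
    \sum_a \sum_b x a * u b * L a b j.
  under eq_bigr do rewrite mulr_suml.
  rewrite exchange_big; apply: eq_bigr => a _ /=.
  under eq_bigr do rewrite mulr_suml.
  rewrite exchange_big; apply: eq_bigr => b _ /=.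
  by rewrite -GamL mulr_sumr; apply: eq_bigr => i _; ring.
have -> : \sum_i \sum_j (\sum_a \sum_b Gam i a b * x a * v b) * G i j * w j =
    \sum_a \sum_i \sum_j x a * v i * w j * L a i j.
  rewrite exchange_big/=; under eq_bigr do rewrite -mulr_suml lower mulr_suml.
  rewrite exchange_big; apply: eq_bigr => a _ /=.
  under eq_bigr do rewrite mulr_suml.
  rewrite exchange_big; apply: eq_bigr => i _ /=.
  by apply: eq_bigr => j _; ring.
have -> : \sum_i \sum_j v i * G i j * (\sum_a \sum_b Gam j a b * x a * w b) =
    \sum_a \sum_i \sum_j x a * v i * w j * L a j i.
  under eq_bigr => i _ do under eq_bigr => j _ do
    rewrite (symG i j) -mulrA (mulrC (G j i)).
  under eq_bigr do rewrite -mulr_sumr lower mulr_sumr.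
  rewrite exchange_big; apply: eq_bigr => a _ /=.
  apply: eq_bigr => i _; rewrite mulr_sumr.
  by apply: eq_bigr => j _; ring.
rewrite -big_split/=; transitivity (\sum_a \sum_i \sum_j x a * v i * w j * D a i j).
  rewrite [RHS]exchange_big/=; apply: eq_bigr => i _.
  rewrite [RHS]exchange_big/=; apply: eq_bigr => j _.
  by rewrite mulr_sumr mulr_suml; apply: eq_bigr => a _; ring.
apply: eq_bigr => a _; rewrite -big_split; apply: eq_bigr => i _ /=.
by rewrite -big_split; apply: eq_bigr => j _ /=; rewrite -LD; ring.
Qed.


(** * Metric compatibility of the covariant derivative along a curve *)

Section FieldsAlongACurve.
Context {R : realType} {m : nat} {M : smooth_manifold R m}.
Variable g : riemannian_metric M.
Variables (I : set R) (gamma : R -> M).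
Hypotheses (aI : no_isolated_point I) (sgamma : smooth_curve I gamma).
Implicit Types (c : chart R m M) (s : R) (V W : R -> 'rV[R]_m).

(** By continuity of [gamma] the parameters sent into a chart domain form a
    relatively open subset of [I]. *)
Lemma within_times_in c s : times_in I gamma c s ->
  within (times_in I gamma c) s^' = within I s^'.
Proof.
move=> [Is cs]; have near_c : within I s^' (fun t => dom c (gamma t)).
  have cg : {for s, continuous (gamma : subspace I -> M)} by exact: sgamma.1.
  have : \forall q \near gamma s, dom c q.
    by apply: open_nbhs_nbhs; split => //; exact: open_dom.
  move=> /cg; rewrite nbhs_simpl /= /nbhs/= -nbhs_subspace_in//.
  by rewrite /dnbhs /within/=; apply: filterS => t + _.
apply/seteqP; split=> P.
  move: near_c; rewrite /within/= => near_c Pc.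
  apply: filterS2 near_c Pc => t ct Pt It.
  by apply: Pt; split => //; exact: ct.
by rewrite /within/=; apply: filterS => t Pt [It _]; exact: Pt.
Qed.

Lemma no_isolated_point_times_in c : no_isolated_point (times_in I gamma c).
Proof. by move=> s ts; rewrite within_times_in//; apply: aI; exact: ts.1. Qed.

Lemma has_derive_in_times_in (U : normedModType R) c (h : R -> U) s d :
  times_in I gamma c s ->
  has_derive_in (times_in I gamma c) h s d -> has_derive_in I h s d.
Proof. by move=> ts; rewrite /has_derive_in within_times_in. Qed.

Lemma smooth_in_charts (U : normedModType R) (h : R -> U) :
  (forall c, atlas M c -> smooth_in (times_in I gamma c) h) -> smooth_in I h.
Proof.
move=> sh; apply: smooth_in_local => s Is.
exists (times_in I gamma (chart_at (gamma s))); split.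
- by split=> //; exact: dom_chart_at.
- by move=> t [].
- by move=> t; exact: within_times_in.
- by apply: sh; exact: chart_at_atlas.
Qed.

Let comps c V t := to_chart c (gamma t) (V t).
Let pos c t := Defs.coord c (gamma t).

Let comps_inner c V W t := \sum_i \sum_j
  comps c V t 0 i * local_form g c (pos c t) i j * comps c W t 0 j.

Lemma inner_times_in c V W : atlas M c -> forall t, times_in I gamma c t ->
  comps_inner c V W t = inner g (gamma t) (V t) (W t).
Proof. by move=> ac t [_ ct]; rewrite (inner_local_form _ _ _ ac ct). Qed.

Lemma pos_img c t : times_in I gamma c t -> (Defs.coord c @` dom c) (pos c t).
Proof. by move=> [_ ct]; exists (gamma t). Qed.

Lemma smooth_inner V W : smooth_field I gamma V -> smooth_field I gamma W ->
  smooth_in I (fun t => inner g (gamma t) (V t) (W t)).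
Proof.
move=> sV sW; apply: smooth_in_charts => c ac; apply/smooth_inP => k.
have aT := @no_isolated_point_times_in c.
apply: Ck_in_eq (inner_times_in V W ac) _; rewrite /comps_inner.
apply: (Ck_in_sum aT) => i; apply: (Ck_in_sum aT) => j.
apply: (Ck_inM aT); last first.
  by apply: (Ck_in_coord aT); apply/smooth_inP: k; exact: sW.
apply: (Ck_inM aT).
  by apply: (Ck_in_coord aT); apply/smooth_inP: k; exact: sV.
apply: (Ck_in_comp (x := pos c) aT k (metric_smooth g ac i j)); first exact: sgamma.2.
by move=> t; exact: pos_img.
Qed.

(** In the chart [c] at [gamma s] the function is [sum v_i g_ij(x) w_j].  The
    product rule and the claimed value share the terms in [v'] and [w']; what is left
    is [sum v_i (dg_ij x') w_j] against the Christoffel terms, and these agree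
    because the Levi-Civita connection is metric. *)
Lemma metric_compatibility V W s :
  smooth_field I gamma V -> smooth_field I gamma W -> I s ->
  has_derive_in I (fun t => inner g (gamma t) (V t) (W t)) s
    (inner g (gamma s) (cov_deriv g I gamma V s) (W s) +
     inner g (gamma s) (V s) (cov_deriv g I gamma W s)).
Proof.
move=> sV sW Is; set p := gamma s; pose c := chart_at p.
have ac : atlas M c := chart_at_atlas p.
have cp : dom c p := dom_chart_at p.
have ts : times_in I gamma c s by split.
apply: (has_derive_in_times_in ts).
apply: (has_derive_in_eq ts (inner_times_in V W ac)); rewrite /comps_inner.
have aT := @no_isolated_point_times_in c.
set T := times_in I gamma c in ts aT *.
pose x' := velocity I gamma s.
pose v' := derive_in T (comps c V) s; pose w' := derive_in T (comps c W) s.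
have dx : has_derive_in T (pos c) s x'.
  by apply: has_derive_in_derive; exact: smooth_in_derivable (sgamma.2 _ ac) ts.
have dv i : has_derive_in T (fun t => comps c V t 0 i) s (v' 0 i).
  apply: (has_derive_in_coord (x := comps c V)); apply: has_derive_in_derive.
  exact: smooth_in_derivable (sV _ ac) ts.
have dw i : has_derive_in T (fun t => comps c W t 0 i) s (w' 0 i).
  apply: (has_derive_in_coord (x := comps c W)); apply: has_derive_in_derive.
  exact: smooth_in_derivable (sW _ ac) ts.
have dG i j : has_derive_in T (fun t => local_form g c (pos c t) i j) s
    (\sum_k x' 0 k * dmetric g c (pos c s) k i j).
  rewrite -diff_delta; apply: (has_derive_in_comp (F := fun y => local_form g c y i j : R)) dx.
  by have [+ _] := metric_smooth g ac i j 1%N; apply; exact: pos_img.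
pose G := local_form g c (pos c s).
have -> : inner g p (cov_deriv g I gamma V s) (W s) +
    inner g p (V s) (cov_deriv g I gamma W s) =
    \sum_i \sum_j
      ((v' 0 i * G i j + V s 0 i * \sum_k x' 0 k * dmetric g c (pos c s) k i j) * W s 0 j
       + V s 0 i * G i j * w' 0 j).
  rewrite !(inner_local_form _ _ _ ac cp) !to_chart_self -/(pos c s) -/G.
  have split_cov U (u' : 'rV[R]_m) i : u' = derive_in T (comps c U) s ->
      cov_deriv g I gamma U s 0 i = u' 0 i +
      \sum_a \sum_b christoffel g c (pos c s) i a b * x' 0 a * U s 0 b.
    by move=> ->; rewrite !mxE.
  under eq_bigr => i _ do under eq_bigr => j _ do
    rewrite (split_cov V v')// !mulrDl.
  under [X in _ + X = _]eq_bigr => i _ do under eq_bigr => j _ do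
    rewrite (split_cov W w')// mulrDr.
  under [RHS]eq_bigr => i _ do under eq_bigr => j _ do
    rewrite mulrDl addrAC.
  have split2 (E1 E2 : 'I_m -> 'I_m -> R) : \sum_i \sum_j (E1 i j + E2 i j) =
      \sum_i \sum_j E1 i j + \sum_i \sum_j E2 i j.
    by rewrite -big_split; apply: eq_bigr => i _; rewrite big_split.
  rewrite !split2 (@lowered_connection_metric _ _ (christoffel g c (pos c s))
    (fun a b j => 2^-1 * (dmetric g c (pos c s) a b j + dmetric g c (pos c s) b a j
       - dmetric g c (pos c s) j a b)) (dmetric g c (pos c s)) G (x' 0) (V s 0) (W s 0)).
  - by rewrite -!addrA; congr (_ + _); rewrite addrCA.
  - by move=> i j; exact: local_formC.
  - by move=> a b j; exact: christoffel_lower.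
  - move=> a b j; rewrite (dmetricC g c _ a j b) (dmetricC g c _ b a j)
      (dmetricC g c _ j a b).
    by field.
apply: has_derive_in_sum => i; apply: has_derive_in_sum => j.
have := has_derive_inM (has_derive_inM (dv i) (dG i j)) (dw j).
by rewrite /comps !to_chart_self.
Qed.

End FieldsAlongACurve.


(** * Components in an orthonormal frame *)

Lemma has_derive_in_cos (R : realType) (A : set R) (h : R -> R) s d :
  has_derive_in A h s d -> has_derive_in A (fun t => cos (h t)) s (- d * sin (h s)).
Proof.
move=> dh; have dc : derivable (cos : R -> R) (h s) 1 by [].
have <- : 'd (cos : R -> R) (h s) d = - d * sin (h s).
  by rewrite deriv1E// derive1E derive_val /GRing.scale/= mulrN mulNr.
by apply: has_derive_in_comp => //; exact/derivable1_diffP.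
Qed.

Section OrthonormalBasis.
Context {R : realType} {m : nat} {M : smooth_manifold R m}.
Variables (g : riemannian_metric M) (p : M) (E : nat -> 'rV[R]_m).
Hypothesis orthoE : forall i j, (1 <= i <= m)%N -> (1 <= j <= m)%N ->
  inner g p (E i) (E j) = (i == j)%:R.

(** If [A] has rows [E 1, ..., E m], orthonormality says that [A] times [G A^T] is
    the identity, so [G A^T], which maps a vector to its components, is
    invertible. *)
Lemma orthonormal_ext u v :
  (forall k, (1 <= k <= m)%N -> inner g p u (E k) = inner g p v (E k)) -> u = v.
Proof.
move=> uv; pose A := \matrix_(i < m) E i.+1.
have innerA x (k : 'I_m) : (x *m (g p *m A^T)) 0 k = inner g p x (E k.+1).
  rewrite mulmxA /inner /form_at [LHS]mxE [RHS]mxE.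
  by apply: eq_bigr => j _; congr (_ * _); rewrite !mxE.
have AG : A *m (g p *m A^T) = 1%:M.
  apply/row_matrixP => i; rewrite row_mul rowK; apply/rowP => k.
  by rewrite innerA orthoE ?ltn_ord// !mxE.
have /mulmx1_unit[_ GU] := AG.
apply: (can_inj (mulmxK GU)); apply/rowP => k; rewrite !innerA.
by apply: uv; rewrite ltn_ord.
Qed.

Lemma inner_expansion (a : nat -> R) k : (1 <= k <= m)%N ->
  inner g p (\sum_(1 <= i < m.+1) a i *: E i) (E k) = a k.
Proof.
move=> km; rewrite inner_suml (bigD1_seq k) ?iota_uniq ?mem_index_iota//=.
rewrite orthoE// eqxx mulr1 big1_seq ?addr0// => i /andP[/negPf ik].
by rewrite mem_index_iota ltnS => im; rewrite orthoE// ik mulr0.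
Qed.

Lemma orthonormal_expansion v :
  v = \sum_(1 <= i < m.+1) inner g p v (E i) *: E i.
Proof. by apply: orthonormal_ext => k km; rewrite inner_expansion. Qed.

Lemma orthonormal_parseval v :
  inner g p v v = \sum_(1 <= i < m.+1) inner g p v (E i) ^+ 2.
Proof.
rewrite {1}(orthonormal_expansion v) inner_suml; apply: eq_bigr => i _.
by rewrite (innerC _ _ (E i)) expr2.
Qed.

End OrthonormalBasis.

Lemma sum_frame (V : nmodType) (m : nat) (F : nat -> V) : (2 <= m)%N ->
  \sum_(1 <= k < m.+1) F k = F 1%N + F 2%N + \sum_(1 <= i < m.-1) F i.+2.
Proof.
case: m => [|[|n]]// _; rewrite big_ltn// big_ltn// addrA; congr (_ + _).
by rewrite (big_addn 1 n.+3 2); apply: eq_big_nat => i _; rewrite addn2.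
Qed.

(** * Components in the Frenet frame *)

Section FrenetComponents.
Context {R : realType} {m : nat} {M : smooth_manifold R m}.
Variables (g : riemannian_metric M) (I : set R) (gamma : R -> M).
Variables (O : set (chart R m M)) (X : nat -> R -> 'rV[R]_m) (kappa : nat -> R -> R).
Hypotheses (hm : (2 <= m)%N) (aI : no_isolated_point I) (sgamma : smooth_curve I gamma).
Hypothesis hX : frenet_frame g I gamma O X kappa.

(** Extending the components by [0] at the indices [0] and [m + 1] turns the first,
    middle and last Frenet equations into the single formula of
    [inner_cov_frame]. *)
Definition component (V : R -> 'rV[R]_m) k s : R :=
  if (1 <= k <= m)%N then inner g (gamma s) (V s) (X k s) else 0.

Lemma componentE V k s : (1 <= k <= m)%N ->
  component V k s = inner g (gamma s) (V s) (X k s).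
Proof. by rewrite /component => ->. Qed.

Lemma inner_cov_frame V k s : I s -> (1 <= k <= m)%N ->
  inner g (gamma s) (V s) (cov_deriv g I gamma (X k) s) =
  - kappa k.-1 s * component V k.-1 s + kappa k s * component V k.+1 s.
Proof.
move=> Is km; have [/andP[k1]] := (km, km); rewrite leq_eqVlt => /orP[/eqP -> _|km' _].
  rewrite (frenet_last hX Is) innerZr [component V m.+1 s]/component ltnn mulr0 addr0.
  by rewrite componentE//; lia.
have [k2|k2] := ltnP 1 k.
  rewrite (frenet_middle hX _ Is); last by lia.
  by rewrite innerDr !innerZr !componentE//; lia.
have -> : k = 1%N by lia.
by rewrite (frenet_first hX Is) innerZr {1}/component mulr0 add0r componentE//; lia.
Qed.

Lemma smooth_component V k : smooth_field I gamma V -> (1 <= k <= m)%N ->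
  smooth_in I (component V k).
Proof.
move=> sV km; rewrite /component km.
exact: (@smooth_inner _ _ _ g _ _ aI sgamma _ _ sV (frame_smooth hX km)).
Qed.

Lemma derive_component V k s : smooth_field I gamma V -> I s -> (1 <= k <= m)%N ->
  derive_in I (component V k) s =
  inner g (gamma s) (cov_deriv g I gamma V s) (X k s)
  - kappa k.-1 s * component V k.-1 s + kappa k s * component V k.+1 s.
Proof.
move=> sV Is km; rewrite /component km; apply: derive_inE => //.
have := metric_compatibility (g := g) aI sgamma sV (frame_smooth hX km) Is.
by rewrite inner_cov_frame// mulNr addrA.
Qed.

(** A vector is determined by its components, and by metric compatibility those of
    the covariant derivative of [V] are the derivatives of the components of [V]
    corrected by the Frenet equations. *)
Lemma torse_components V f w s : smooth_field I gamma V -> I s ->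
  cov_deriv g I gamma V s = f *: velocity I gamma s + w *: V s <->
  forall k, (1 <= k <= m)%N -> derive_in I (component V k) s =
    f * (k == 1%N)%:R + w * component V k s
    - kappa k.-1 s * component V k.-1 s + kappa k s * component V k.+1 s.
Proof.
move=> sV Is.
have rhs k : (1 <= k <= m)%N ->
    inner g (gamma s) (f *: velocity I gamma s + w *: V s) (X k s) =
    f * (k == 1%N)%:R + w * component V k s.
  move=> km; rewrite innerDl !innerZl -(frame_tangent hX Is).
  by rewrite (frame_orthonormal hX)//; [rewrite eq_sym componentE|lia].
split=> [tV k km|comp]; first by rewrite derive_component// tV rhs.
apply: (orthonormal_ext (g := g) (p := gamma s) (E := X^~ s)).
  by move=> i j im jm; exact: frame_orthonormal hX _ _ _ im jm Is.
move=> k km; rewrite rhs//; have := comp k km; rewrite derive_component//.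
by move/addIr/addIr.
Qed.

(** Differentiate the constant [<V, V> = 1]. *)
Lemma torse_unit_form V f w s : smooth_field I gamma V -> I s ->
  (forall t, I t -> inner g (gamma t) (V t) (V t) = 1) ->
  cov_deriv g I gamma V s = f *: velocity I gamma s + w *: V s ->
  w = - f * component V 1 s.
Proof.
move=> sV Is unit tV.
have d1 := metric_compatibility (g := g) aI sgamma sV sV Is.
have d0 : has_derive_in I (fun t => inner g (gamma t) (V t) (V t)) s 0.
  by apply: has_derive_in_eq (has_derive_in_cst I (1 : R) s) => // t It; rewrite unit.
have := derive_inE aI Is d1; rewrite (derive_inE aI Is d0) (innerC _ _ (V s)).
rewrite tV innerDl !innerZl unit// componentE; last by lia.
by rewrite (frame_tangent hX Is) (innerC _ _ _ (V s)) => h; lra.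
Qed.

(** The second component is [cos theta], with derivative [- theta' sin theta]; the
    four equations are the component equations for [k = 1], [2], [3] and [k >= 4],
    where [k = i + 2] for [lam i]. *)
Lemma torse_components_system V f w (lam : nat -> R -> R) (theta : R -> R) s :
  I s -> derivable_in I theta s ->
  (forall t, I t -> component V 1 t = lam 0%N t) ->
  (forall t, I t -> component V 2 t = cos (theta t)) ->
  (forall i t, (0 < i)%N -> I t -> component V i.+2 t = lam i t) ->
  w = - f * lam 0%N s ->
  (forall k, (1 <= k <= m)%N -> derive_in I (component V k) s =
    f * (k == 1%N)%:R + w * component V k s
    - kappa k.-1 s * component V k.-1 s + kappa k s * component V k.+1 s) <->
  [/\ f * (1 - lam 0%N s ^+ 2) - derive_in I (lam 0%N) s
        + kappa 1%N s * cos (theta s) = 0,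
      - f * lam 0%N s * cos (theta s) + derive_in I theta s * sin (theta s)
        - lam 0%N s * kappa 1%N s + lam 1%N s * kappa 2%N s = 0,
      (3 <= m)%N ->
      - f * lam 0%N s * lam 1%N s - derive_in I (lam 1%N) s
        + lam 2%N s * kappa 3%N s - kappa 2%N s * cos (theta s) = 0
    & forall i, (2 <= i <= m - 2)%N ->
      - f * lam 0%N s * lam i s - derive_in I (lam i) s
        - lam i.-1 s * kappa i.+1 s + lam i.+1 s * kappa i.+2 s = 0].
Proof.
move=> Is dtheta e1 e2 e3 ->.
have d1 : derive_in I (component V 1) s = derive_in I (lam 0%N) s.
  exact: derive_in_eq.
have d2 : derive_in I (component V 2) s = - derive_in I theta s * sin (theta s).
  rewrite (derive_in_eq Is e2); apply: derive_inE => //.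
  exact/has_derive_in_cos/has_derive_in_derive.
have d3 i : (0 < i)%N -> derive_in I (component V i.+2) s = derive_in I (lam i) s.
  by move=> i0; apply: derive_in_eq => // t; exact: e3.
split=> [comp|[s1 s2 s3 s4] [|[|[|[|i]]]]//= km].
- split=> [||m3|i i2].
  + have := comp 1%N; rewrite /= d1 e1// e2// {1}/component mulr0 subr0 mulr1.
    by move=> ->; [ring|lia].
  + have := comp 2%N; rewrite /= d2 e1// e2// e3// mulr0 add0r.
    by move=> h; have := h ltac:(lia); lra.
  + have := comp 3%N; rewrite /= d3// e2// !e3// mulr0 add0r.
    by move=> ->; [ring|lia].
  + case: i i2 => [|[|i]]// i2.
    have := comp i.+4; rewrite /= d3// !e3// mulr0 add0r.
    by move=> ->; [ring|lia].
- rewrite d1 e1// e2// {1}/component/= mulr0 subr0; lra.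
- rewrite d2 e1// e2// e3//; lra.
- rewrite d3// e2// !e3//; have := s3 ltac:(lia); lra.
- rewrite d3// !e3//; have := s4 i.+2 ltac:(lia) => /=; lra.
Qed.

End FrenetComponents.


(** * The characterization *)

Theorem theorem3p2 (R : realType) (m : nat) (hm : (2 <= m)%N)
  (M : smooth_manifold R m) (hM : connected [set: M])
  (O : set (chart R m M)) (hO : is_orientation O)
  (g : riemannian_metric M)
  (I : set R) (hI : is_interval I) (hI2 : exists a b, [/\ I a, I b & a < b])
  (gamma : R -> M)
  (hgamma : frenet_curve g I gamma) (harc : arc_length g I gamma)
  (X : nat -> R -> 'rV[R]_m) (kappa : nat -> R -> R)
  (hX : frenet_frame g I gamma O X kappa)
  (V : R -> 'rV[R]_m) (hV : smooth_field I gamma V)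
  (hV0 : nowhere_zero I V) (hVpar : ~ parallel g I gamma V)
  (f w theta : R -> R)
  (hf : smooth_in I f) (hw : smooth_in I w) (htheta : smooth_in I theta)
  (htheta_range : forall s, I s -> 0 <= theta s <= pi) :
  (torse_forming g I gamma V f w /\ PA_curve g I gamma (X 2%N) V theta)
  <->
  (exists l : nat -> R -> R,
    let lam := trunc m.-1 l in
    [/\ forall i, (i < m.-1)%N -> smooth_in I (l i),
        forall s, I s ->
          V s = lam 0%N s *: X 1%N s + cos (theta s) *: X 2%N s
                + \sum_(1 <= i < m.-1) lam i s *: X i.+2 s,
        forall s, I s ->
          cos (theta s) ^+ 2 + \sum_(0 <= i < m.-1) lam i s ^+ 2 = 1,
        forall s, I s ->
          [/\ f s * (1 - lam 0%N s ^+ 2) - derive_in I (lam 0%N) s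
                + kappa 1%N s * cos (theta s) = 0,
              - f s * lam 0%N s * cos (theta s)
                + derive_in I theta s * sin (theta s)
                - lam 0%N s * kappa 1%N s + lam 1%N s * kappa 2%N s = 0,
              (3 <= m)%N ->
              - f s * lam 0%N s * lam 1%N s - derive_in I (lam 1%N) s
                + lam 2%N s * kappa 3%N s - kappa 2%N s * cos (theta s) = 0
            & forall i, (2 <= i <= m - 2)%N ->
              - f s * lam 0%N s * lam i s - derive_in I (lam i) s
                - lam i.-1 s * kappa i.+1 s + lam i.+1 s * kappa i.+2 s = 0]
      & forall s, I s -> w s = - f s * inner g (gamma s) (V s) (X 1%N s)]).
Proof.
have aI := no_isolated_point_interval hI hI2.
have sgamma := hgamma.1.
pose c := component g gamma X V.
have cE := @componentE _ _ _ g gamma X V.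
have normE s : I s -> inner g (gamma s) (V s) (V s) =
    c 2%N s ^+ 2 + (c 1%N s ^+ 2 + \sum_(1 <= i < m.-1) c i.+2 s ^+ 2).
  move=> Is; rewrite (orthonormal_parseval (E := X^~ s)); last first.
    by move=> i j im jm; exact: frame_orthonormal hX _ _ _ im jm Is.
  rewrite addrA (addrC (c 2%N s ^+ 2)) -(@sum_frame _ _ (fun k => c k s ^+ 2))//.
  by apply: eq_big_nat => k; rewrite ltnS => km; rewrite /c cE.
split=> [[[_ _ tV] PA]|[l]].
- have unit t : I t -> inner g (gamma t) (V t) (V t) = 1.
    move=> It; have [V1 _] := PA t It.
    have : 0 < tnorm g (gamma t) (V t) by rewrite V1.
    by rewrite sqrtr_gt0 => /ltW /sqr_sqrtr <-; rewrite -/(tnorm _ _ _) V1 expr1n.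
  have cosE t : I t -> c 2%N t = cos (theta t).
    by move=> It; rewrite (PA t It).2 /c cE.
  (* The zero extension of the components agrees with that of [trunc]. *)
  pose l i := c (if i is 0 then 1%N else i.+2).
  have lamE : trunc m.-1 l = l.
    apply/funext => -[|i]; apply/funext => t; rewrite /trunc; first by case: ifP => //; lia.
    by case: ltnP => // mi; rewrite /l /c /component ifF//; lia.
  exists l => lam; rewrite {}/lam lamE; split.
  + move=> [|i] im; apply: (smooth_component aI sgamma hX hV); lia.
  + move=> s Is; rewrite -cosE//.
    have -> : \sum_(1 <= i < m.-1) l i s *: X i.+2 s =
        \sum_(1 <= i < m.-1) c i.+2 s *: X i.+2 s.
      by apply: eq_big_nat => -[].
    rewrite -(@sum_frame _ _ (fun k => c k s *: X k s))//.
    rewrite {1}(@orthonormal_expansion _ _ _ g (gamma s) (X^~ s) _ (V s)).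
      by apply: eq_big_nat => k; rewrite ltnS => km; rewrite /c cE.
    by move=> i j im jm; exact: frame_orthonormal hX _ _ _ im jm Is.
  + move=> s Is; rewrite -(unit s Is) normE// cosE// big_ltn; last by lia.
    by do 2 congr (_ + _); apply: eq_big_nat => -[].
  + move=> s Is.
    have wE := torse_unit_form hm aI sgamma hX hV Is unit (tV s Is).
    apply/(@torse_components_system _ _ _ g _ gamma X kappa hm aI V (f s) (w s)
      l theta s) => //.
    * exact: smooth_in_derivable.
    * by case.
    * exact: (torse_components hm aI sgamma hX (f s) (w s) hV Is).1 (tV s Is).
  + move=> s Is; rewrite (torse_unit_form hm aI sgamma hX hV Is unit (tV s Is)) cE//.
    by lia.
(* [a s k] is the coefficient of [X k] in the given expansion of [V]. *)
- pose lam := trunc m.-1 l; rewrite -/lam => -[sl VE norm1 sys wE].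
  pose a s k := if k is k'.+3 then lam k'.+1 s else
    if k is 2%N then cos (theta s) else lam 0%N s.
  have VaE s : I s -> V s = \sum_(1 <= k < m.+1) a s k *: X k s.
    move=> Is; rewrite VE// (@sum_frame _ _ (fun k => a s k *: X k s))//.
    by congr (_ + _); apply: eq_big_nat => -[].
  have caE s k : I s -> (1 <= k <= m)%N -> c k s = a s k.
    move=> Is km; rewrite /c cE// VaE// inner_expansion//.
    by move=> i j im jm; exact: frame_orthonormal hX _ _ _ im jm Is.
  have c1 t : I t -> c 1%N t = lam 0%N t by move=> It; rewrite caE//; lia.
  have c2 t : I t -> c 2%N t = cos (theta t) by move=> It; rewrite caE//; lia.
  have c3 i t : (0 < i)%N -> I t -> c i.+2 t = lam i t.
    case: i => // i _ It; have [im|im] := leqP i.+3 m; first by rewrite caE.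
    by rewrite /c /component /lam /trunc !ifF//; lia.
  have unit s : I s -> inner g (gamma s) (V s) (V s) = 1.
    move=> Is; rewrite normE// c1// c2// -(norm1 s Is) [in RHS]big_ltn; last by lia.
    by do 2 congr (_ + _); apply: eq_big_nat => i /andP[i0 _]; rewrite c3.
  split.
  + split=> // s Is.
    apply/(torse_components hm aI sgamma hX (f s) (w s) hV Is).
    apply/(@torse_components_system _ _ _ g _ gamma X kappa hm aI V (f s) (w s)
      lam theta s) => //.
    * exact: smooth_in_derivable.
    * by rewrite -c1// /c cE ?wE//; lia.
    * exact: sys.
  + move=> s Is; rewrite /tnorm unit// sqrtr1; split=> //.
    by rewrite -c2// /c cE.
Qed.
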